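(* Let $c_1\ge0$, $c_2\in\mathbb R$ with $|c_2|\,\|\mathbb B\mathbb B^*\|<1$, $T:=I-c_2\mathbb B\mathbb B^*$, let $F\in C(E;U)$ and $\hat{\mathbb V}\in C^1(E;\mathbb R)$ satisfy $\mathbb BF(X)=T\nabla\hat{\mathbb V}(X)$ for all $X\in E$, and let $\hat X\in E$. Let $X,V\in C^1([0,\infty);E)$ be solutions to the closed-loop system $$\frac{d}{dt}\begin{pmatrix}X_t\\ V_t\end{pmatrix}=\left(\begin{pmatrix}0&T\\-T&0\end{pmatrix}-\begin{pmatrix}0&0\\0&T\Psi(X_t)T+c_1T^{1/2}\mathbb B\mathbb B^*T^{1/2}\end{pmatrix}\right)\nabla H_{\mathrm{cl}}(X_t,V_t),\qquad X(0)=X_0,\ V(0)=V_0,$$ where $H_{\mathrm{cl}}(X,V)=\frac12\langle V,T^{-1}V\rangle+\mathbb V(X)+\hat{\mathbb V}(X)$. Consider the following assertions: (i) The potential $\mathbb V+\hat{\mathbb V}\in C^1(E;\mathbb R)$ is bounded from below by a constant. (ii) $\nabla\mathbb V+\nabla\hat{\mathbb V}\in C(E;E)$ is uniformly continuous and the family $(\nabla\mathbb V(X_t)+\nabla\hat{\mathbb V}(X_t))_{t\ge0}\subseteq E$ is bounded. (iii) There exists $\nu>0$ such that $\Psi(Y)+c_1T^{-1/2}\mathbb B\mathbb B^*T^{-1/2}\ge\nu I$ for all $Y\in E$. (iv) For every $\varepsilon>0$ there exists $\delta>0$ such that for all $Y\in E$: $\|\nabla\mathbb V(Y)+\nabla\hat{\mathbb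 V}(Y)\|\le\delta$ implies $\|Y-\hat X\|\le\varepsilon$. If (i), (ii) and (iii) are satisfied, then $V_t\to0$ and $\nabla\mathbb V(X_t)+\nabla\hat{\mathbb V}(X_t)\to0$ in $E$ as $t\to\infty$. If additionally (iv) is satisfied, then $X_t\to\hat X$ in $E$ as $t\to\infty$.
   Context: Standing assumptions. $E,U$ are real Hilbert spaces with norms $\|\cdot\|$ and inner products $\langle\cdot,\cdot\rangle$; gradients are Riesz gradients. $\mathbb V\in C^1(E;\mathbb R)$ is bounded from below by $\underline{\mathcal V}\in\mathbb R$ and there is $C>0$ with $\|\nabla\mathbb V(X)\|^2\le C(1+\mathbb V(X)-\underline{\mathcal V})$ for all $X\in E$. $\Psi:E\to\mathscr L(E)$ is bounded (i.e. $\sup_X\|\Psi(X)\|<\infty$) and $\Psi(X)$ is self-adjoint and positive semidefinite for every $X\in E$. $\mathbb B\in\mathscr L(U;E)$ has closed range. For bounded operators, $S_1\ge S_2$ means $S_1-S_2$ is self-adjoint and positive semidefinite. Since $|c_2|\|\mathbb B\mathbb B^*\|<1$, $T$ is self-adjoint, positive definite and boundedly invertible. Componentwise the closed-loop system reads $\frac{d}{dt}X_t=V_t$, $\frac{d}{dt}V_t=-c_1\mathbb B\mathbb B^*V_t-T(\Psi(X_t)V_t+\nabla\mathbb V(X_t)+\nabla\hat{\mathbb V}(X_t))$. *)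

(* Defs.v *)
From HB Require Import structures.
From mathcomp Require Import all_boot all_order all_algebra.
From mathcomp Require Import sesquilinear.
From mathcomp Require Import all_classical all_reals all_analysis.

Set Implicit Arguments.
Unset Strict Implicit.
Unset Printing Implicit Defensive.

Import Order.TTheory GRing.Theory Num.Theory.
Import numFieldNormedType.Exports.

Local Open Scope classical_set_scope.
Local Open Scope ring_scope.

HB.mixin Record CompleteNormedModule_isHilbert (R : realType) E
    & CompleteNormedModule R E := {
  inner : {dot E for (@idfun R)} ;
  inner_norm : forall x : E, inner x x = `|x| ^+ 2
}.

#[short(type="hilbertType")]
HB.structure Definition Hilbert (R : realType) :=
  { E of CompleteNormedModule_isHilbert R E & CompleteNormedModule R E }.

Notation "''[' x , y ]" := (inner x y) : ring_scope.

(* Bounded linear operators, the elements of L(E; F), are represented as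
   continuous functions of type {linear E -> F}. *)

(* For a bounded operator the set is bounded and nonempty; otherwise sup is 0. *)
Definition opnorm (R : realType) (E F : normedModType R) (A : E -> F) : R :=
  sup [set `|A x| | x in [set x | `|x| <= 1]].

Definition C1 (R : realType) (E F : normedModType R) (f : E -> F) : Prop :=
  (forall x, differentiable f x) /\
  (forall x, opnorm ('d f y \- 'd f x) @[y --> x] --> (0 : R)).

(* Riesz gradient with respect to the form ip. The form is a parameter because
   the library norm of E * E is the max norm, so that E * E is not a
   hilbertType; differentiability only depends on the topology. *)
Definition gradient (R : realType) (E : normedModType R) (ip : E -> E -> R)
    (f : E -> R) (x : E) : E :=
  get [set g | forall v, 'd f x v = ip g v].

Definition prod_inner (R : realType) (E : hilbertType R) (p q : E * E) : R :=
  '[p.1, q.1] + '[p.2, q.2].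

Notation grad := (gradient inner).
Notation grad2 := (gradient (@prod_inner _ _)).

(* The [get]-based operations below select the unique object with the stated
   property; they take an arbitrary default value when there is none. *)
Section Operators.
Context {R : realType}.

Definition adjoint (E F : hilbertType R) (A : E -> F) (y : F) : E :=
  get [set z | forall x, '[A x, y] = '[x, z]].

Context {E : hilbertType R}.

Definition self_adjoint (A : E -> E) : Prop :=
  forall x y, '[A x, y] = '[x, A y].

Definition psd (A : E -> E) : Prop := forall x, 0 <= '[A x, x].

Definition op_ge (S1 S2 : E -> E) : Prop :=
  self_adjoint (S1 \- S2) /\ psd (S1 \- S2).

Definition op_inv (A : E -> E) : {linear E -> E} :=
  get [set S : {linear E -> E} | continuous S /\ cancel A S /\ cancel S A].

Definition op_sqrt (A : E -> E) : {linear E -> E} :=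
  get [set S : {linear E -> E} |
    continuous S /\ self_adjoint S /\ psd S /\ S \o S = A].

Definition block_op (A B C D : E -> E) (p : E * E) : E * E :=
  (A p.1 + B p.2, C p.1 + D p.2).

End Operators.

(* Derivative relative to D, one-sided at boundary points of D. *)
Section DeriveWithin.
Context {R : realType} {E : normedModType R}.
Implicit Types (D : set R) (f : R -> E).

Definition diff_quotient f (t s : R) : E := (s - t)^-1 *: (f s - f t).

Definition derivable_within D f (t : R) : Prop :=
  cvg (diff_quotient f t s @[s --> within (D `\ t) (nbhs t)]).

Definition derive_within D f (t : R) : E :=
  lim (diff_quotient f t s @[s --> within (D `\ t) (nbhs t)]).

Definition C1_within D f : Prop :=
  (forall t, D t -> derivable_within D f t) /\
  {within D, continuous (derive_within D f)}.

End DeriveWithin.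

Section ClosedLoop.
Context {R : realType} {E U : hilbertType R}.
Variables (B : U -> E) (c1 c2 : R).

Definition BBs : E -> E := B \o adjoint B.

Definition Top : E -> E := idfun \- (c2 \*: BBs).

Definition H_cl (P Phat : E -> R) (z : E * E) : R :=
  2^-1 * '[z.2, op_inv Top z.2] + P z.1 + Phat z.1.

Definition J_cl : E * E -> E * E := block_op \0 Top (\- Top) \0.

Definition R_cl (Psi : E -> E -> E) (x : E) : E * E -> E * E :=
  block_op \0 \0 \0
    (Top \o Psi x \o Top \+ c1 \*: (op_sqrt Top \o BBs \o op_sqrt Top)).

End ClosedLoop.

(* Main.v *)
Require Import Defs.
From HB Require Import structures.
From mathcomp Require Import all_boot all_order all_algebra.
From mathcomp Require Import sesquilinear ring lra.
From mathcomp Require Import all_classical all_reals all_analysis.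

Import Order.TTheory GRing.Theory Num.Theory.
Import numFieldNormedType.Exports.

Set Implicit Arguments.
Unset Strict Implicit.

Local Open Scope classical_set_scope.
Local Open Scope ring_scope.

(* Along a solution, the energy [H_cl (X t, V t)] has derivative
   [- '[V, (Psi (X t) + c1 T^(-1/2) B B^* T^(-1/2)) V] <= - nu |V|^2]. Hence it
   decreases and [V] is bounded. Since [G (X t)], [G] being the gradient of the
   total potential, is bounded as well, [V'] is bounded, so [V] is Lipschitz. If
   [|V s| >= eps], then [|V| >= eps / 2] on an interval of fixed length after [s]
   and the energy drops there by a fixed amount; this cannot happen for large
   [s], so [V] tends to [0]. On a short interval after [s], [V'] differs from
   [- T (G (X s))] by little, because [X] is Lipschitz, [G] is uniformly
   continuous and [V] is small; as [V] barely changes on this interval,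
   [T (G (X s))] is small, and so is [G (X s)]. *)

(** * Hilbert spaces *)

Section InnerProduct.
Context {R : realType} {E : hilbertType R}.
Implicit Types x y z : E.

Lemma innerC x y : '[x, y] = '[y, x].
Proof. by rewrite hermC expr0 mul1r. Qed.

Lemma innerDl x y z : '[x + y, z] = '[x, z] + '[y, z].
Proof. exact: linearDl. Qed.

Lemma innerNl x y : '[- x, y] = - '[x, y].
Proof. exact: linearNl. Qed.

Lemma innerZl (a : R) x y : '[a *: x, y] = a * '[x, y].
Proof. exact: linearZl_LR. Qed.

Lemma innerDr x y z : '[x, y + z] = '[x, y] + '[x, z].
Proof. by rewrite innerC innerDl !(innerC x). Qed.

Lemma innerNr x y : '[x, - y] = - '[x, y].
Proof. by rewrite innerC innerNl innerC. Qed.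

Lemma innerZr (a : R) x y : '[x, a *: y] = a * '[x, y].
Proof. by rewrite innerC innerZl innerC. Qed.

Lemma innerBl x y z : '[x - y, z] = '[x, z] - '[y, z].
Proof. by rewrite innerDl innerNl. Qed.

Lemma innerBr x y z : '[x, y - z] = '[x, y] - '[x, z].
Proof. by rewrite innerDr innerNr. Qed.

Lemma inner0l x : '[0, x] = 0.
Proof. by rewrite -(scale0r 0) innerZl mul0r. Qed.

Lemma inner0r x : '[x, 0] = 0.
Proof. by rewrite innerC inner0l. Qed.

Lemma inner_ge0 x : 0 <= '[x, x].
Proof. by rewrite inner_norm sqr_ge0. Qed.

Lemma inner_eq0 x : '[x, x] = 0 -> x = 0.
Proof. by rewrite inner_norm => /eqP; rewrite sqrf_eq0 normr_eq0 => /eqP. Qed.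

Lemma inner_inj x y : (forall z, '[x, z] = '[y, z]) -> x = y.
Proof.
move=> h; apply/eqP; rewrite -subr_eq0; apply/eqP/inner_eq0.
by rewrite innerBl h subrr.
Qed.

Definition innerE := (innerDl, innerDr, innerNl, innerNr, innerZl, innerZr).

Lemma cauchy_schwarz x y : `|'[x, y]| <= `|x| * `|y|.
Proof.
rewrite -(ler_pXn2r (n := 2)) ?nnegrE// ?mulr_ge0// exprMn -!inner_norm.
rewrite real_normK ?num_real//.
have [->|y0] := eqVneq y 0; first by rewrite !inner0r expr0n mulr0.
have yy : 0 < '[y, y] by rewrite inner_norm exprn_gt0// normr_gt0.
have := inner_ge0 ('[y, y] *: x - '[x, y] *: y).
rewrite !innerE (innerC y x).
set a := '[x, x]; set b := '[y, y]; set c := '[x, y] => h.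
have : 0 <= b * (a * b - c ^+ 2).
  by apply: le_trans h _; rewrite le_eqVlt; apply/orP; left; apply/eqP; ring.
by rewrite pmulr_rge0// subr_ge0.
Qed.

Lemma inner_le x y : '[x, y] <= `|x| * `|y|.
Proof. exact: le_trans (ler_norm _) (cauchy_schwarz x y). Qed.

Lemma inner_linear y : linear (inner^~ y : E -> R).
Proof. by move=> a u v; rewrite innerDl innerZl. Qed.

Definition inner_fun y : {linear E -> R} :=
  HB.pack (inner^~ y : E -> R) (GRing.isLinear.Build _ _ _ _ _ (inner_linear y)).

End InnerProduct.

(** * Bounded linear operators and the operator norm *)

Section BoundedOperators.
Context {R : realType}.

Lemma linear_bound_continuous (E F : normedModType R) (f : {linear E -> F})
    (k : R) : (forall x, `|f x| <= k * `|x|) -> continuous f.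
Proof.
move=> h; apply: bounded_linear_continuous; apply/linear_boundedP.
near=> r => x; apply: le_trans (h x) _; apply: ler_wpM2r => //.
Unshelve. all: end_near. Qed.

Lemma inner_fun_continuous (E : hilbertType R) (y : E) : continuous (inner_fun y).
Proof.
by apply: (linear_bound_continuous (k := `|y|)) => x; rewrite mulrC cauchy_schwarz.
Qed.

Lemma cvg_innerl (E : hilbertType R) (T : Type) (F : set_system T)
    (u : T -> E) (l y : E) :
  Filter F -> u @ F --> l -> '[u t, y] @[t --> F] --> '[l, y].
Proof. by move=> FF ul; exact: (cvg_comp _ _ ul (@inner_fun_continuous _ y l)). Qed.

Section OperatorNorm.
Context {E F : normedModType R} (A : {linear E -> F}).
Hypothesis Ac : continuous A.

Lemma opnorm_ubound (y : E) : `|y| <= 1 -> `|A y| <= opnorm A.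
Proof.
move=> y1; apply: sup_ubound; last by exists y.
have [k k0 Ak] := linear_lipschitz Ac.
exists k => _ [x /= x1 <-]; apply: le_trans (Ak x) _.
by rewrite ler_piMr// ltW.
Qed.

Lemma opnorm_ge0 : 0 <= opnorm A.
Proof. by apply: le_trans (normr_ge0 (A 0)) (opnorm_ubound _); rewrite normr0. Qed.

Lemma opnorm_le (x : E) : `|A x| <= opnorm A * `|x|.
Proof.
have [->|x0] := eqVneq x 0; first by rewrite linear0 !normr0 mulr0.
have nx : 0 < `|x| by rewrite normr_gt0.
rewrite -ler_pdivrMr// mulrC.
have -> : `|x|^-1 * `|A x| = `|A (`|x|^-1 *: x)|.
  by rewrite linearZ normrZ normfV normr_id.
by apply: opnorm_ubound; rewrite normrZ normfV normr_id mulVf// gt_eqF.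
Qed.

End OperatorNorm.

End BoundedOperators.

(** * The Riesz representation theorem *)

Section Riesz.
Context {R : realType}.

Lemma cauchy_seq_cvgn (E : completeNormedModType R) (u : nat -> E) :
  (forall e : R, 0 < e -> exists N, forall i j, (N <= i)%N -> (N <= j)%N ->
     `|u i - u j| < e) -> cvgn u.
Proof.
move=> h; apply/cauchy_cvgP/cauchy_ballP => e e0; near_simpl.
have [N hN] := h e e0.
exists ([set n | (N <= n)%N], [set n | (N <= n)%N]); first by split; exists N.
by move=> [i j] [/= Ni Nj]; rewrite -ball_normE /=; exact: hN.
Qed.

(** First-order optimality condition: near a minimum the linear term of the variation must vanish,
    since it would dominate for small [t]. *)
Lemma linear_le_quadratic_eq0 (b c : R) :
  (forall t, 0 <= t * c + t ^+ 2 * b) -> c = 0.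
Proof.
move=> h; apply/eqP/negPn/negP => c0.
have b0 : 0 <= b by have := h 1; have := h (-1); lra.
have b1 : 0 < b + 1 by rewrite ltr_wpDl.
(* The denominator [b + 1] instead of [b] covers the case [b = 0]. *)
have := h (- c / (b + 1)).
have -> : - c / (b + 1) * c + (- c / (b + 1)) ^+ 2 * b = - (c / (b + 1)) ^+ 2.
  by field; rewrite gt_eqF.
rewrite leNgt oppr_lt0 exprn_even_gt0//= mulf_neq0// invr_neq0// gt_eqF//.
Qed.

(* The representative is the minimizer of [|x|^2 / 2 - f x]; by the parallelogram
   identity every minimizing sequence is Cauchy. *)
Lemma riesz (E : hilbertType R) (f : {linear E -> R}) :
  continuous f -> exists g, forall v, f v = '[g, v].
Proof.
move=> fc; have [k k0 fk] := linear_lipschitz fc.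
have fD x y : f (x + y) = f x + f y by exact: linearD.
have fZ a x : f (a *: x) = a * f x by exact: linearZ.
pose J (x : E) : R := 2^-1 * '[x, x] - f x.
have Jlb x : - (2^-1 * k ^+ 2) <= J x.
  have := fk x; rewrite ler_norml => /andP[_ fx].
  rewrite /J inner_norm; have : 0 <= (`|x| - k) ^+ 2 by rewrite sqr_ge0.
  rewrite sqrrB; nra.
have Jinf : has_inf (range J).
  split; first by exists (J 0), 0.
  by exists (- (2^-1 * k ^+ 2)) => _ [x _ <-].
pose m := inf (range J).
have mJ x : m <= J x by apply: ge_inf; [exact: Jinf.2|exists x].
have [u Ju] : {u : nat -> E & forall n, J (u n) < m + n.+1%:R^-1}.
  suff /choice[u hu] : forall n, exists x, J x < m + n.+1%:R^-1 by exists u.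
  move=> n; have [//|_ [x _ <-] Jx] := @inf_adherent _ (range J) n.+1%:R^-1 _ Jinf.
  by exists x.
have par i j : `|u i - u j| ^+ 2 <= 4 * (i.+1%:R^-1 + j.+1%:R^-1).
  have := mJ (2^-1 *: (u i + u j)); have := Ju i; have := Ju j.
  rewrite /J -inner_norm fZ fD !innerE (innerC (u j) (u i)).
  set ei := i.+1%:R^-1; set ej := j.+1%:R^-1.
  set a := '[u i, u i]; set b := '[u j, u j]; set c := '[u i, u j].
  set p := f (u i); set q := f (u j); lra.
have /cvg_ex[l ul] : cvgn u.
  apply: cauchy_seq_cvgn => e e0.
  (* Each of the two terms in [par], multiplied by 4, then stays below [e ^+ 2 / 2]. *)
  have e8 : 0 < e ^+ 2 / 8 by rewrite divr_gt0// exprn_gt0.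
  have /cvgrPdist_lt/(_ _ e8) [N _ hN] := @cvg_harmonic R.
  exists N => i j Ni Nj.
  have := hN i Ni; have := hN j Nj; rewrite /= !sub0r !normrN !ger0_norm//.
  move=> hj hi; rewrite -(ltr_pXn2r (n := 2)) ?nnegrE ?(ltW e0)//.
  apply: le_lt_trans (par i j) _.
  by move: hi hj; set a := i.+1%:R^-1; set b := j.+1%:R^-1; lra.
exists l => v.
apply/eqP; rewrite eq_sym -subr_eq0; apply/eqP.
apply: (@linear_le_quadratic_eq0 (2^-1 * '[v, v])) => t.
(* Expand [m <= J (u n + t *: v)] around [J (u n)], which exceeds [m] by less than [harmonic n];
   this error disappears in the limit. *)
have key n : 0 <= t * ('[u n, v] - f v) + t ^+ 2 * (2^-1 * '[v, v]) + harmonic n.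
  have := mJ (u n + t *: v); have := Ju n.
  by rewrite /J fD fZ !innerE (innerC v (u n)) /harmonic /=; set a := n.+1%:R^-1; lra.
have lim : t * ('[u n, v] - f v) + t ^+ 2 * (2^-1 * '[v, v]) + harmonic n
   @[n --> \oo] --> t * ('[l, v] - f v) + t ^+ 2 * (2^-1 * '[v, v]) + 0.
  apply: cvgD; last exact: cvg_harmonic.
  apply: cvgD; last exact: cvg_cst.
  apply: cvgM; first exact: cvg_cst.
  apply: cvgB; last exact: cvg_cst.
  exact: cvg_innerl.
rewrite -[leRHS]addr0; apply: (cvgr_to_ge lim); exact: nearW key.
Qed.

End Riesz.

(** * Inverses and square roots of perturbations of the identity *)

Section OperatorTheory.
Context {R : realType} {E : hilbertType R}.
Implicit Types A : {linear E -> E}.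

Definition mk_linear (F G : normedModType R) (f : F -> G) (fl : linear f) :
  {linear F -> G} := HB.pack f (GRing.isLinear.Build _ _ _ _ _ fl).

Lemma cvg_norm_le (u : nat -> E) (l : E) (a : nat -> R) :
  (forall n, `|u n - l| <= a n) -> a n @[n --> \oo] --> 0 -> u n @[n --> \oo] --> l.
Proof.
move=> ua a0; apply/cvgrPdist_lt => e e0.
move/cvgrPdist_lt/(_ e e0) : a0; apply: filterS => n /=; rewrite sub0r normrN => h.
by rewrite distrC (le_lt_trans (ua n))// (le_lt_trans (ler_norm _)).
Qed.

Lemma one_minus_ge A (q : R) x :
  (forall x, `|A x| <= q * `|x|) -> (1 - q) * `|x| <= `|x - A x|.
Proof.
move=> Aq; have := Aq x; have := lerB_dist x (A x).
by rewrite mulrBl mul1r; lra.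
Qed.

Lemma geometric_cvgn (u : nat -> E) (C q : R) : 0 <= q -> q < 1 ->
  (forall k n, `|u (n + k)%N - u n| <= C * q ^+ n) -> cvgn u.
Proof.
move=> q0 q1 uq; apply: cauchy_seq_cvgn => e e0.
have e2 : 0 < e / 2 by rewrite divr_gt0.
have : geometric C q n @[n --> \oo] --> 0.
  by apply: cvg_geometric; rewrite ger0_norm.
move=> /cvgrPdist_lt/(_ _ e2) [N _ hN].
have hu i : (N <= i)%N -> `|u i - u N| < e / 2.
  move=> Ni; rewrite -(subnKC Ni); apply: le_lt_trans (uq _ _) _.
  have := hN N (leqnn _); rewrite /= sub0r normrN.
  exact/le_lt_trans/ler_norm.
exists N => i j Ni Nj; rewrite (le_lt_trans (ler_distD (u N) _ _))//.
by rewrite (splitr e) ltrD ?hu// distrC hu.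
Qed.

(** The equation [x - A x = y] is solved by iterating [x |-> y + A x] from 0, which produces the
    partial sums of the Neumann series. The lower bound [one_minus_ge] gives uniqueness and the
    continuity of the inverse. *)
Lemma neumann_inverse A (q : R) : 0 <= q -> q < 1 ->
  (forall x, `|A x| <= q * `|x|) ->
  exists S : {linear E -> E},
    continuous S /\ cancel (idfun \- A) S /\ cancel S (idfun \- A).
Proof.
move=> q0 q1 Aq.
have q1' : 0 < 1 - q by rewrite subr_gt0.
have Ac : continuous A := linear_bound_continuous Aq.
have inj x y : x - A x = y - A y -> x = y.
  move=> xy; apply/eqP; rewrite -subr_eq0 -normr_eq0 eq_le normr_ge0 andbT.
  have := one_minus_ge (x - y) Aq.
  have -> : x - y - A (x - y) = (x - A x) - (y - A y).
    by rewrite linearB !opprD !opprK addrACA.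
  by rewrite xy subrr normr0 pmulr_rle0.
have surj y : exists x, x - A x = y.
  pose z := fun n => iter n (fun x => y + A x) 0.
  have zS n : z n.+1 = y + A (z n) by [].
  have zb k : `|z k| <= (1 - q)^-1 * `|y|.
    elim: k => [|k ih]; first by rewrite normr0 mulr_ge0// invr_ge0 ltW.
    rewrite zS (le_trans (ler_normD _ _))//.
    apply: le_trans (lerD (lexx _) (Aq _)) _.
    apply: le_trans (lerD (lexx _) (ler_wpM2l q0 ih)) _.
    by rewrite le_eqVlt; apply/orP; left; apply/eqP; field; rewrite gt_eqF.
  have zk k n : `|z (n + k)%N - z n| <= (1 - q)^-1 * `|y| * q ^+ n.
    elim: n => [|n ih]; first by rewrite add0n subr0 expr0 mulr1.
    rewrite addSn !zS opprD addrACA subrr add0r -linearB.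
    by apply: le_trans (Aq _) _; rewrite exprS mulrCA ler_wpM2l.
  have /cvg_ex[l zl] := geometric_cvgn q0 q1 zk.
  exists l; apply/eqP; rewrite subr_eq; apply/eqP.
  have zSl : [sequence z n.+1]_n @ \oo --> l by rewrite cvg_shiftS.
  apply: (norm_cvg_unique zSl).
  by apply: cvgD; [exact: cvg_cst|exact: (cvg_comp _ _ zl (@Ac l))].
(* Solutions are chosen pointwise; injectivity forces the choice to be linear. *)
have [S hS] := choice surj.
have Sl : linear S.
  move=> a x y; apply: inj; rewrite hS linearD linearZ /= opprD addrACA.
  by rewrite hS -scalerBr hS.
exists (mk_linear Sl); split; last by split=> x /=; [exact: inj (hS _)|exact: hS].
apply: (@linear_bound_continuous _ _ _ _ (1 - q)^-1) => x /=.
by rewrite ler_pdivlMl// -{2}(hS x); exact: one_minus_ge.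
Qed.

(* Writing the root as [I - Y], the equation becomes [Y = (A + Y^2) / 2], whose
   right-hand side contracts the ball of radius [q]. *)
Lemma sqrt_one_minus A (q : R) : 0 <= q -> q < 1 ->
  (forall x, `|A x| <= q * `|x|) -> self_adjoint A ->
  exists S : {linear E -> E},
    continuous S /\ self_adjoint S /\ psd S /\ S \o S = idfun \- A.
Proof.
move=> q0 q1 Aq As.
pose Y := fun n => iter n (fun (Z : E -> E) x => 2^-1 *: (A x + Z (Z x))) \0.
have YS n x : Y n.+1 x = 2^-1 *: (A x + Y n (Y n x)) by [].
have Yl n : linear (Y n).
  elim: n => [|n ih] a x y; first by rewrite /= scaler0 addr0.
  have AP : A (a *: x + y) = a *: A x + A y by exact: linearP.
  rewrite !YS !ih AP addrACA -(scalerDr a) (scalerDr 2^-1 (a *: _)) !scalerA.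
  by rewrite (mulrC a).
have YB n x y : Y n (x - y) = Y n x - Y n y by exact: (linearB (mk_linear (Yl n))).
have Yq n x : `|Y n x| <= q * `|x|.
  elim: n x => [|n ih] x; first by rewrite /= normr0 mulr_ge0.
  rewrite YS normrZ ger0_norm ?invr_ge0//.
  have := ler_normD (A x) (Y n (Y n x)); have := Aq x.
  have := ih (Y n x); have := ih x; have := normr_ge0 x.
  have := normr_ge0 (Y n x); nra.
have Ys n : self_adjoint (Y n).
  elim: n => [|n ih] x y; first by rewrite /= inner0l inner0r.
  by rewrite !YS !innerE As !ih.
have Yk k n x : `|Y (n + k)%N x - Y n x| <= q * `|x| * q ^+ n.
  elim: n x => [|n ih] x; first by rewrite add0n subr0 expr0 mulr1.
  rewrite addSn !YS -scalerBr normrZ ger0_norm ?invr_ge0//.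
  rewrite opprD addrACA subrr add0r.
  (* With [Z := Y (n + k)], split [Z (Z x) - Y n (Y n x)] as [Z (Z x - Y n x)] plus
     [(Z - Y n) (Y n x)]. Each term is at most [q * (q * |x| * q ^+ n)], and the factor [2^-1]
     absorbs the sum of the two. *)
  rewrite -(subrK (Y (n + k)%N (Y n x)) (Y (n + k)%N (Y (n + k)%N x))) -YB -addrA.
  have := ler_normD (Y (n + k)%N (Y (n + k)%N x - Y n x))
    (Y (n + k)%N (Y n x) - Y n (Y n x)).
  have := Yq (n + k)%N (Y (n + k)%N x - Y n x).
  have := ih (Y n x); have := ler_wpM2l q0 (ih x).
  have := ler_wpM2l (mulr_ge0 q0 (exprn_ge0 n q0)) (Yq n x).
  rewrite exprS; lra.
have cvY x : cvgn (Y^~ x) := geometric_cvgn q0 q1 (fun k n => Yk k n x).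
pose L x := limn (Y^~ x).
have YL x : Y n x @[n --> \oo] --> L x by exact: cvY.
have Ll : linear L.
  move=> a x y; apply: cvg_lim => //.
  have -> : Y^~ (a *: x + y) = (fun n => a *: Y n x + Y n y).
    by apply/funext => n; rewrite Yl.
  by apply: cvgD => //; apply: cvgZr.
have Lq x : `|L x| <= q * `|x|.
  by apply: (cvgr_to_le (cvg_norm (YL x))); apply: nearW => n; exact: Yq.
have Ls : self_adjoint L.
  move=> x y; apply: (@cvg_unique _ _ ('[Y n x, y] @[n --> \oo])) => //.
    exact: cvg_innerl.
  have -> : (fun n => '[Y n x, y]) = (fun n => '[Y n y, x]).
    by apply/funext => n; rewrite Ys innerC.
  by rewrite innerC; exact: cvg_innerl.
have LE x : L x = 2^-1 *: (A x + L (L x)).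
  have YSL : [sequence Y n.+1 x]_n @ \oo --> L x by rewrite (cvg_shiftS (Y^~ x)).
  apply: (norm_cvg_unique YSL).
  apply: cvgZr; apply: cvgD; first exact: cvg_cst.
  (* Pointwise convergence passes through the composition because all [Y n] share the bound [q]; the
     intermediate point is [Y n (L x)]. *)
  have a0 : q * `|Y n x - L x| + `|Y n (L x) - L (L x)| @[n --> \oo] --> (0 : R).
    rewrite -[X in _ --> X]addr0; apply: cvgD.
      rewrite -[X in _ --> X](mulr0 q); apply: cvgM; first exact: cvg_cst.
      by apply/norm_cvg0P; apply/subr_cvg0.
    by apply/norm_cvg0P; apply/subr_cvg0.
  suff hb n : `|Y n (Y n x) - L (L x)| <= q * `|Y n x - L x| + `|Y n (L x) - L (L x)|.
    exact: cvg_norm_le hb a0.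
  rewrite -(subrK (Y n (L x)) (Y n (Y n x))) -YB -addrA.
  by rewrite (le_trans (ler_normD _ _))// lerD2r.
have Lc : continuous (mk_linear Ll).
  exact: (@linear_bound_continuous _ _ _ (mk_linear Ll) q Lq).
exists (idfun \- mk_linear Ll); split=> [|].
  by move=> x; apply: cvgB; [exact: cvg_id|exact: Lc].
split; first by move=> x y; rewrite /= !innerE Ls.
split=> [x|].
  rewrite /= innerDl innerNl subr_ge0 (le_trans (inner_le _ _))//.
  rewrite inner_norm expr2 ler_wpM2r// (le_trans (Lq _))//.
  by rewrite ler_piMl// ltW.
apply/funext => x /=; rewrite -[L (x - L x)]/(mk_linear Ll (x - L x)) linearB /=.
have LE2 : L x + L x = A x + L (L x).
  by rewrite {1 2}LE -scalerDl (_ : 2^-1 + 2^-1 = 1 :> R) ?scale1r//; field.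
have -> : A x = L x + L x - L (L x) by rewrite LE2 addrK.
by rewrite !opprB -addrA opprD; congr (x + _); rewrite addrCA.
Qed.

End OperatorTheory.

(** * Powers of the operator [T] *)

Section AdjointTheory.
Context {R : realType} {E U : hilbertType R}.
Variable B : {linear U -> E}.
Hypothesis Bc : continuous B.

(** Riesz representation of [x |-> '[B x, y]] shows that the [get] in [adjoint] does not fall back
    on its default value. *)
Lemma adjointP x y : '[B x, y] = '[x, adjoint B y].
Proof.
move: x; rewrite /adjoint.
apply: (@getPex _ [set z | forall x, '[B x, y] = '[x, z]]).
have fc : continuous (inner_fun y \o B).
  by move=> x; apply: continuous_comp; [exact: Bc|exact: inner_fun_continuous].
have [g hg] := riesz (f := inner_fun y \o B) fc.
by exists g => x; rewrite [RHS]innerC -hg.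
Qed.

Lemma adjoint_linear : linear (adjoint B).
Proof.
move=> a x y; apply: inner_inj => z.
by rewrite [LHS]innerC -adjointP !innerE !adjointP !(innerC z).
Qed.

Lemma adjoint_bound : exists2 k : R, 0 < k & forall y, `|adjoint B y| <= k * `|y|.
Proof.
have [k k0 Bk] := linear_lipschitz Bc; exists k => // y.
have [->|a0] := eqVneq (adjoint B y) 0; first by rewrite normr0 mulr_ge0// ltW.
have an : 0 < `|adjoint B y| by rewrite normr_gt0.
rewrite -(ler_pM2l an) -expr2 -inner_norm -adjointP (le_trans (inner_le _ _))//.
by rewrite mulrCA mulrA ler_wpM2r.
Qed.

Lemma BBs_linear : linear (BBs B).
Proof. by move=> a x y; rewrite /BBs /= adjoint_linear linearP. Qed.

Lemma BBs_continuous : continuous (mk_linear BBs_linear).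
Proof.
have [k k0 Bk] := linear_lipschitz Bc; have [l l0 al] := adjoint_bound.
apply: (@linear_bound_continuous _ _ _ _ (k * l)) => x /=.
by rewrite (le_trans (Bk _))// -mulrA ler_wpM2l// ltW.
Qed.

Lemma BBs_self_adjoint : self_adjoint (BBs B).
Proof. by move=> x y; rewrite /BBs /= adjointP innerC [RHS]innerC adjointP. Qed.

(** Take [A] to be [c2] times [BBs B]. The facts about the inverse and the root of [T] are then
    derived from this form alone. *)
Lemma TopE (c2 : R) : `|c2| * opnorm (BBs B) < 1 ->
  exists (A : {linear E -> E}) (q : R),
    [/\ 0 <= q, q < 1, forall x, `|A x| <= q * `|x|, self_adjoint A &
        Top B c2 = idfun \- A].
Proof.
move=> c2s; pose A : {linear E -> E} := c2 \*: mk_linear BBs_linear.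
exists A, (`|c2| * opnorm (BBs B)); split => //.
- by rewrite mulr_ge0//; exact: (opnorm_ge0 BBs_continuous).
- move=> x; rewrite /A /= normrZ -mulrA ler_wpM2l//.
  exact: (opnorm_le BBs_continuous x).
- by move=> x y; rewrite /A /= innerZl innerZr BBs_self_adjoint.
Qed.

End AdjointTheory.

Section NearIdentity.
Context {R : realType} {E : hilbertType R}.
Variables (T : E -> E) (A : {linear E -> E}) (q : R).
Hypotheses (q0 : 0 <= q) (q1 : q < 1) (Aq : forall x, `|A x| <= q * `|x|).
Hypotheses (As : self_adjoint A) (TA : T = idfun \- A).

Lemma op_invP : [/\ continuous (op_inv T), cancel T (op_inv T) & cancel (op_inv T) T].
Proof.
have [c1 [c2 c3]] : [set S : {linear E -> E} | continuous S /\ cancel T S /\ cancel S T]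
  (op_inv T).
  by apply: getPex; rewrite TA; exact: neumann_inverse q0 q1 Aq.
by split.
Qed.

Lemma near_id_self_adjoint : self_adjoint T.
Proof. by move=> x y; rewrite TA /= !innerE As. Qed.

Lemma near_id_le2 x : `|T x| <= 2 * `|x|.
Proof.
rewrite TA /= (le_trans (ler_normB _ _))//.
rewrite (mulrDl 1 1) mul1r lerD2l (le_trans (Aq x))//.
by rewrite ler_piMl// ltW.
Qed.

Lemma op_inv_self_adjoint : self_adjoint (op_inv T).
Proof.
have [_ TK KT] := op_invP.
by move=> x y; rewrite -{2}(KT x) near_id_self_adjoint KT.
Qed.

(** With [w] the image of [v] under the inverse, ['[T w, w] >= (1 - q) * |w|^2], while
    [|v| = |T w| <= 2 * |w|]; hence the constant [(1 - q) / 4]. *)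
Lemma op_inv_coercive :
  exists2 a : R, 0 < a & forall v, a * `|v| ^+ 2 <= '[v, op_inv T v].
Proof.
have [_ TK KT] := op_invP; exists ((1 - q) / 4).
  by rewrite divr_gt0// subr_gt0.
have q1' : 0 <= 1 - q by rewrite subr_ge0 ltW.
move=> v; rewrite -{1 2}(KT v); set w := op_inv T v.
have h : (1 - q) * `|w| ^+ 2 <= '[T w, w].
  rewrite TA /= innerBl inner_norm mulrBl mul1r lerD2l lerN2.
  rewrite (le_trans (inner_le _ _))//.
  by rewrite expr2 mulrA ler_wpM2r.
apply: le_trans h; rewrite -mulrA ler_wpM2l// ler_pdivrMl//.
have -> : 4 * `|w| ^+ 2 = (2 * `|w|) ^+ 2 by ring.
by rewrite lerXn2r ?nnegrE ?mulr_ge0// near_id_le2.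
Qed.

Lemma op_sqrtP : [/\ continuous (op_sqrt T), self_adjoint (op_sqrt T) &
  forall x, op_sqrt T (op_sqrt T x) = T x].
Proof.
have [c1 [c2 [_ c3]]] : [set S : {linear E -> E} |
    continuous S /\ self_adjoint S /\ psd S /\ S \o S = T] (op_sqrt T).
  by apply: getPex; rewrite TA; exact: sqrt_one_minus q0 q1 Aq As.
by split=> // x; rewrite -[LHS]/((_ \o _) x) c3.
Qed.

(** With [S] the root, the explicit inverse is [op_inv T \o S]: it is a left inverse because
    [S \o S = T], and a right inverse because [S] is injective. *)
Lemma op_inv_sqrtP :
  cancel (op_sqrt T) (op_inv (op_sqrt T)) /\ cancel (op_inv (op_sqrt T)) (op_sqrt T).
Proof.
have [Sc Ss SS] := op_sqrtP; have [Ic TK KT] := op_invP.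
set S := op_sqrt T in Sc Ss SS *.
have SK : cancel S (op_inv T \o S) by move=> x; rewrite /= SS TK.
suff : [set Z : {linear E -> E} | continuous Z /\ cancel S Z /\ cancel Z S] (op_inv S).
  by case=> _ [].
pose Z : {linear E -> E} := op_inv T \o S.
apply: getPex; exists Z; split.
  by move=> x; apply: continuous_comp; [exact: Sc|exact: Ic].
split=> // x; apply: (can_inj SK).
by rewrite SS /= KT.
Qed.

(** Links the factor [T^(1/2)] of the damping operator, applied to the momentum gradient [T^(-1) v],
    with the [T^(-1/2)] of condition (iii). *)
Lemma op_sqrt_inv v : op_sqrt T (op_inv T v) = op_inv (op_sqrt T) v.
Proof.
have [_ TK KT] := op_invP; have [_ _ SS] := op_sqrtP; have [SK KS] := op_inv_sqrtP.
by rewrite -{2}(KT v) -SS SK.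
Qed.

Lemma op_inv_sqrt_self_adjoint : self_adjoint (op_inv (op_sqrt T)).
Proof.
have [SK KS] := op_inv_sqrtP; have [_ Ss _] := op_sqrtP.
by move=> x y; rewrite -{2}(KS x) Ss KS.
Qed.

End NearIdentity.

(** * Derivatives and gradients *)

Section Calculus.
Context {R : realType}.

Lemma is_derive_comp_diff (W W' : normedModType R) (f : W -> W') (Y : R -> W)
    (t : R) (y : W) :
  differentiable f (Y t) -> is_derive t 1 Y y ->
  is_derive t 1 (f \o Y) ('d f (Y t) y).
Proof.
move=> df [dY <-].
have dY' : differentiable Y t by apply/derivable1_diffP.
have dfY : differentiable (f \o Y) t by exact: differentiable_comp.
split; first exact/derivable1_diffP.
by rewrite !deriveE// diff_comp.
Qed.

Lemma is_derive_linear (W W' : normedModType R) (f : {linear W -> W'})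
    (Y : R -> W) (t : R) (y : W) :
  continuous f -> is_derive t 1 Y y -> is_derive t 1 (f \o Y) (f y).
Proof.
move=> fc dY; rewrite -[X in is_derive _ _ _ X](_ : 'd f (Y t) y = f y).
  by apply: is_derive_comp_diff => //; exact: linear_differentiable.
by rewrite (diff_lin (Y t) fc).
Qed.

Lemma derivable_within_is_derive (W : normedModType R) (f : R -> W) (t : R) :
  0 < t -> derivable_within `[0, +oo[ f t ->
  is_derive t 1 f (derive_within `[0, +oo[ f t).
Proof.
move=> t0 df.
suff key : (fun h : R => h^-1 *: ((f \o shift t) (h *: 1) - f t)) @ 0^' -->
    derive_within `[0, +oo[ f t.
  by split; [apply/cvg_ex; eexists; exact: key|exact: cvg_lim key].
move=> S hS; have := df S hS.
rewrite /nbhs/= /within/= => /nbhs_ballP[e /= e0 he].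
(* Increments smaller than [t] keep the point inside the half-line, so the relative and the
   two-sided difference quotients agree. *)
exists (Num.min e t) => /=; first by rewrite lt_min e0.
move=> h /=; rewrite sub0r normrN lt_min => /andP[he' ht] h0.
have := he (h + t); rewrite /diff_quotient addrK /shift /= /GRing.scale /= mulr1; apply.
  by rewrite /= opprD addrCA subrr addr0 normrN.
split.
  rewrite in_itv /= andbT; move: ht; rewrite ltr_norml => /andP[h1 _].
  by rewrite -(addNr t) lerD2r ltW.
by move=> /eqP; rewrite -subr_eq0 addrK; exact/negP.
Qed.

Lemma derivable_within_pair (W W' : normedModType R) (D : set R) (f : R -> W)
    (g : R -> W') (t : R) :
  derivable_within D f t -> derivable_within D g t ->
  derivable_within D (fun s => (f s, g s)) t.
Proof.
move=> df dg; apply/cvg_ex; exists (derive_within D f t, derive_within D g t).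
by apply: cvg_pair; [exact: df|exact: dg].
Qed.

Lemma is_derive_pairP (W W' : normedModType R) (f : R -> W) (g : R -> W') (t : R)
    (p : W * W') :
  is_derive t 1 (fun s => (f s, g s)) p -> is_derive t 1 f p.1 /\ is_derive t 1 g p.2.
Proof.
move=> dp.
pose p1 : {linear (W * W')%type -> W} := fst.
pose p2 : {linear (W * W')%type -> W'} := snd.
split.
  by apply: (is_derive_linear (f := p1) _ dp) => z; exact: cvg_fst.
by apply: (is_derive_linear (f := p2) _ dp) => z; exact: cvg_snd.
Qed.

(* The scalar mean value theorem applied to [r |-> '[W r, W b - W a]]. *)
Lemma mean_value_norm (E : hilbertType R) (W w : R -> E) (a b M : R) : a < b ->
  (forall r, r \in `[a, b] -> is_derive r 1 W (w r)) ->
  (forall r, r \in `[a, b] -> `|w r| <= M) ->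
  `|W b - W a| <= M * (b - a).
Proof.
move=> ab dW wM; pose u := W b - W a.
have M0 : 0 <= M by apply: le_trans (normr_ge0 (w a)) (wM a _); rewrite bound_itvE ltW.
have du r : r \in `[a, b] -> is_derive r 1 (inner_fun u \o W) (inner_fun u (w r)).
  by move=> rab; apply: is_derive_linear; [exact: inner_fun_continuous|exact: dW].
have cont : {within `[a, b], continuous (inner_fun u \o W)}.
  by apply: derivable_within_continuous => r rab; have [] := du r rab.
have du' r : r \in `]a, b[ -> is_derive r 1 (inner_fun u \o W) (inner_fun u (w r)).
  by move=> rab; apply: du; apply: subset_itv_oo_cc.
have [r rab] := MVT ab du' cont.
rewrite /= -innerBl -/u inner_norm => h.
have [->|u0] := eqVneq u 0; first by rewrite normr0 mulr_ge0// subr_ge0 ltW.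
have nu : 0 < `|u| by rewrite normr_gt0.
rewrite -(ler_pM2l nu) -expr2 h mulrA ler_wpM2r ?subr_ge0 ?(ltW ab)//.
apply: (le_trans (inner_le (w r) u)); rewrite mulrC ler_wpM2l ?wM//.
exact: subset_itv_oo_cc.
Qed.

End Calculus.

(** * Riesz gradients and the gradient of the energy *)

Section Gradient.
Context {R : realType} {E : hilbertType R}.

Lemma gradP (f : E -> R) (x v : E) : differentiable f x -> 'd f x v = '[grad f x, v].
Proof.
move=> df; move: v; rewrite /gradient.
apply: (@getPex _ [set g | forall v, 'd f x v = '[g, v]]).
exact: riesz (diff_continuous df).
Qed.

Variable Q : {linear E -> E}.
Hypotheses (Qc : continuous Q) (Qs : self_adjoint Q).

(** Self-adjointness of [Q] merges the two cross terms into ['[h, Q v]]; the remainder [2^-1 *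
    '[h, Q h]] is quadratic in [h], hence negligible. *)
Lemma is_diff_quadratic (v : E) :
  is_diff v (fun w => 2^-1 * '[w, Q w]) (inner_fun (Q v)).
Proof.
pose q := fun w => 2^-1 * '[w, Q w].
have lq : q \o shift v = cst (q v) + inner_fun (Q v) +o_ 0 id.
  apply/eqaddoP => e e0.
  have [k k0 Qk] := linear_lipschitz Qc.
  have ek : 0 < e / k by rewrite divr_gt0.
  near=> h.
  have hk : `|h| < e / k.
    by near: h; apply/nbhs_norm0P; exists (e / k).
  have -> : (q \o shift v - (cst (q v) + inner_fun (Q v))) h = q h.
    rewrite /q /= !fctE /= linearD !innerE.
    rewrite -(Qs v h) (innerC (Q v) h).
    set a := '[h, Q h]; set b := '[h, Q v]; set c := '[v, Q v]; lra.
  rewrite /q normrM ger0_norm ?invr_ge0//.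
  have := cauchy_schwarz h (Q h); have := Qk h; have := normr_ge0 h.
  have : k * `|h| <= e by rewrite mulrC -ler_pdivlMr// ltW.
  set a := `|'[h, Q h]|; set b := `|h|; set c := `|Q h| => h1 h2 h3 h4.
  have h5 : b * c <= b * e by rewrite ler_wpM2l// (le_trans h3).
  by rewrite mulrC in h5; have : 0 <= e * b; [rewrite mulr_ge0// ltW|rewrite /=; lra].
split; last exact: diff_unique (@inner_fun_continuous _ _ _) lq.
apply/diff_locallyP; rewrite (diff_unique (@inner_fun_continuous _ _ _) lq).
by split => //; exact: inner_fun_continuous.
Unshelve. all: end_near. Qed.

Variables (P Phat : E -> R) (z : E * E).
Hypotheses (Pd : differentiable P z.1) (Phatd : differentiable Phat z.1).

Let H (y : E * E) : R := 2^-1 * '[y.2, Q y.2] + P y.1 + Phat y.1.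
Let g : E * E := (grad P z.1 + grad Phat z.1, Q z.2).

Lemma is_diff_energy : is_diff z H (prod_inner g).
Proof.
pose p1 : {linear (E * E)%type -> E} := fst.
pose p2 : {linear (E * E)%type -> E} := snd.
have d1 : is_diff z p1 p1.
  have c : continuous p1 by move=> y; exact: cvg_fst.
  by split; [exact: linear_differentiable|exact: diff_lin].
have d2 : is_diff z p2 p2.
  have c : continuous p2 by move=> y; exact: cvg_snd.
  by split; [exact: linear_differentiable|exact: diff_lin].
have dq := is_diff_comp d2 (is_diff_quadratic z.2).
have dP := is_diff_comp d1 (differentiableP Pd).
have dPh := is_diff_comp d1 (differentiableP Phatd).
apply: is_diff_eq (is_diffD (is_diffD dq dP) dPh) _.
apply/funext => -[w1 w2].
transitivity ('[w2, Q z.2] + 'd P (z.1) w1 + 'd Phat (z.1) w1); first by [].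
have gw : prod_inner g (w1, w2) =
    '[grad P z.1, w1] + '[grad Phat z.1, w1] + '[Q z.2, w2] by rewrite -innerDl.
have sum_eq (p h k p' h' k' : R) : p = p' -> h = h' -> k = k' ->
    k + p + h = p' + h' + k' by move=> -> -> ->; rewrite -addrA addrC.
apply: etrans (esym gw).
exact: sum_eq (gradP w1 Pd) (gradP w1 Phatd) (innerC w2 _).
Qed.

(** Since [E * E] is not a [hilbertType], uniqueness of the representative is checked by testing
    against the vectors [(v, 0)] and [(0, v)]. *)
Lemma grad2_energy : grad2 H z = g.
Proof.
have [_ dH] := is_diff_energy.
apply: get_unique => [v|g' hg']; first by rewrite dH.
have h v : prod_inner g' v = prod_inner g v by rewrite -hg' dH.
case: g' {hg'} h => g1 g2 h; congr (_, _); apply: inner_inj => v.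
  by have := h (v, 0); rewrite /prod_inner /= !inner0r !addr0.
by have := h (0, v); rewrite /prod_inner /= !inner0r !add0r.
Qed.

End Gradient.

(** * Asymptotics of the damped system *)

Section Barbalat.
Context {R : realType} {E : hilbertType R}.

Lemma unif_continuous_norm (f : E -> E) : unif_continuous f ->
  forall eps : R, 0 < eps -> exists2 d : R, 0 < d &
    forall x y, `|x - y| < d -> `|f x - f y| < eps.
Proof.
move=> fu eps e0.
have /fu := entourage_ball (E : pseudoMetricType R) (PosNum e0).
rewrite /= /nbhs/= -entourage_ballE => -[d /= d0 hd]; exists d => // x y xy.
have := hd (x, y); rewrite /= -!ball_normE /=; exact.
Qed.

Lemma cvg_pinfty_norm (f : R -> E) (l : E) :
  (forall eps : R, 0 < eps -> exists s0, forall s, s0 <= s -> `|f s - l| <= eps) ->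
  f t @[t --> +oo] --> l.
Proof.
move=> h; apply/cvgrPdist_le => e e0; have [s0 hs] := h e e0.
exists s0; split; first exact: num_real.
by move=> t ts; rewrite distrC; apply: hs; exact: ltW.
Qed.

Lemma decrease_rate (e e' : R -> R) (a b c : R) : a <= b ->
  (forall r, a <= r <= b -> is_derive r 1 e (e' r)) ->
  (forall r, a <= r <= b -> e' r <= - c) ->
  e b <= e a - c * (b - a).
Proof.
rewrite le_eqVlt => /predU1P[<-|ab] de he; first by rewrite subrr mulr0 subr0.
have cont : {within `[a, b], continuous e}.
  apply: derivable_within_continuous => r; rewrite in_itv => rab.
  by have [] := de r rab.
have de' r : r \in `]a, b[ -> is_derive r 1 e (e' r).
  by rewrite in_itv /= => /andP[ar rb]; apply: de; rewrite !ltW.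
have [r] := MVT ab de' cont; rewrite in_itv /= => /andP[ar rb] h.
have her : e' r <= - c by apply: he; rewrite !ltW.
rewrite -lerBlDl h -mulNr ler_wpM2r// subr_ge0 ltW//.
Qed.

(** Abstract form of the problem: [D] is the damping term in the equation for [V], and [e] is the
    energy along the solution. *)
Variables (X V : R -> E) (G : E -> E) (T : {linear E -> E}) (D : E -> E -> E).
Variables (e e' : R -> R) (nu m a M K k tau : R).
Hypotheses (nu0 : 0 < nu) (a0 : 0 < a) (M0 : 0 < M) (K0 : 0 < K) (k0 : 0 < k)
  (tau0 : 0 < tau).
Hypothesis Ttau : forall x, `|T x| <= tau * `|x|.
Hypothesis Tk : forall x, `|x| <= k * `|T x|.
Hypothesis DK : forall x v, `|D x v| <= K * `|v|.
Hypothesis GM : forall t : R, 0 <= t -> `|G (X t)| <= M.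
Hypothesis Gu : unif_continuous G.
Hypothesis dX : forall t : R, 0 < t -> is_derive t 1 X (V t).
Hypothesis dV : forall t : R, 0 < t -> is_derive t 1 V (- T (G (X t)) - D (X t) (V t)).
Hypothesis de : forall t : R, 0 < t -> is_derive t 1 e (e' t).
Hypothesis e'_le : forall t : R, 0 < t -> e' t <= - (nu * `|V t| ^+ 2).
Hypothesis e_ge : forall t : R, m + a * `|V t| ^+ 2 <= e t.

(** Estimates start at time 1 because two-sided derivatives are available only at positive times. *)
Let posr (s r : R) : 1 <= s -> s <= r -> 0 < r.
Proof. by move=> s1 sr; apply: lt_le_trans (le_trans s1 sr). Qed.

Lemma energy_nonincreasing s t : 1 <= s -> s <= t -> e t <= e s.
Proof.
move=> s1 st.
have := @decrease_rate e e' s t 0 st; rewrite mul0r subr0; apply.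
  by move=> r /andP[sr _]; apply: de; exact: posr sr.
move=> r /andP[sr _]; rewrite oppr0 (le_trans (e'_le (posr s1 sr)))//.
by rewrite oppr_le0 mulr_ge0 ?sqr_ge0// ltW.
Qed.

Lemma velocity_bounded : exists2 N : R, 0 < N & forall t, 1 <= t -> `|V t| <= N.
Proof.
pose c := (e 1 - m) / a.
have Vc t : 1 <= t -> `|V t| ^+ 2 <= c.
  move=> t1; rewrite /c ler_pdivlMr// mulrC lerBrDl.
  exact: le_trans (e_ge t) (energy_nonincreasing (lexx _) t1).
have c0 : 0 <= c by apply: le_trans (Vc 1 (lexx _)); rewrite sqr_ge0.
(* Since [c < (c + 1) ^+ 2], this bound avoids a square root. *)
exists (c + 1) => [|t /Vc Vt]; first by rewrite ltr_wpDl.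
rewrite leNgt; apply/negP => Vt'; have : (c + 1) ^+ 2 <= `|V t| ^+ 2.
  by rewrite lerXn2r ?nnegrE// ?addr_ge0// ltW.
by nra.
Qed.

Lemma velocity_lipschitz : exists2 L : R, 0 < L &
  forall s t, 1 <= s -> s <= t -> `|V t - V s| <= L * (t - s).
Proof.
have [N N0 VN] := velocity_bounded; exists (tau * M + K * N).
  by rewrite addr_gt0// mulr_gt0.
move=> s t s1; rewrite le_eqVlt => /predU1P[<-|st].
  by rewrite !subrr normr0 mulr0.
apply: (mean_value_norm st (w := fun t => - T (G (X t)) - D (X t) (V t))).
  by move=> r; rewrite in_itv /= => /andP[sr _]; apply: dV; exact: posr sr.
move=> r; rewrite in_itv /= => /andP[sr _].
rewrite (le_trans (ler_normB _ _))// normrN lerD//.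
  by rewrite (le_trans (Ttau _))// ler_wpM2l ?(ltW tau0)// GM// ltW// (posr s1).
rewrite (le_trans (DK _ _))// ler_wpM2l ?(ltW K0)// VN//.
exact: le_trans sr.
Qed.

Lemma velocity_cvg eps : 0 < eps ->
  exists2 s0, 1 <= s0 & forall s, s0 <= s -> `|V s| <= eps.
Proof.
move=> eps0; have [L L0 VL] := velocity_lipschitz.
(* Within time [d] the velocity changes by at most [eps / 2]; [eta] below is the energy lost
   meanwhile if [|V| >= eps / 2]. *)
pose d := eps / (2 * L).
have d0 : 0 < d by rewrite divr_gt0// mulr_gt0.
pose eta := nu * (eps / 2) ^+ 2 * d.
have eta0 : 0 < eta by rewrite mulr_gt0// mulr_gt0// exprn_gt0// divr_gt0.
have einf : has_inf (e @` [set t | 1 <= t]).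
  split; first by exists (e 1), 1 => /=.
  exists m => _ [t _ <-]; apply: le_trans (e_ge t).
  by rewrite lerDl mulr_ge0 ?sqr_ge0// ltW.
(* At [s0] the energy is within [eta] of its infimum, so a later loss of [eta] is impossible. *)
have [_ [s0 /= s01 <-] hs0] := inf_adherent eta0 einf.
exists s0 => // s ss0; rewrite leNgt; apply/negP => Vs.
have s1 : 1 <= s := le_trans s01 ss0.
have ssd : s <= s + d by rewrite lerDl ltW.
have Vr r : s <= r <= s + d -> eps / 2 <= `|V r|.
  move=> /andP[sr rd]; have := VL s r s1 sr; have := lerB_dist (V s) (V r).
  rewrite distrC => h1 h2.
  have : L * (r - s) <= eps / 2.
    rewrite (_ : eps / 2 = L * d); first by rewrite ler_wpM2l ?(ltW L0)// lerBlDl.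
    by rewrite /d; field; rewrite gt_eqF.
  by lra.
have dec : e (s + d) <= e s - nu * (eps / 2) ^+ 2 * (s + d - s).
  apply: (decrease_rate ssd) => r /andP[sr rd].
    by apply: de; exact: posr sr.
  apply: le_trans (e'_le (posr s1 sr)) _.
  rewrite lerN2 ler_wpM2l ?(ltW nu0)// lerXn2r ?nnegrE ?divr_ge0 ?(ltW eps0)//.
  by apply: Vr; rewrite sr.
have := energy_nonincreasing s01 ss0.
have : inf (e @` [set t | 1 <= t]) <= e (s + d).
  by apply: ge_inf; [exact: einf.2|exists (s + d) => //=; exact: le_trans ssd].
move: dec hs0; rewrite (addrC s) addrK -/eta; lra.
Qed.

(* [r |-> V r + (r - s) T (G (X s))] has a small derivative on [s, s + d], while
   [V] is small at both ends. *)
Lemma gradient_cvg eps : 0 < eps ->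
  exists2 s0, 1 <= s0 & forall s, s0 <= s -> `|G (X s)| <= eps.
Proof.
move=> eps0; have [N N0 VN] := velocity_bounded.
(* The constants give [k * tau * e1 = eps / 4] and [k * (K + 2 / d) * e2 = eps / 4], where [2 / d]
   accounts for [V] at the two ends of the interval. The length [d] keeps [X] within [eta] of
   [X s]. *)
pose e1 := eps / (4 * k * tau).
have e10 : 0 < e1 by rewrite divr_gt0// !mulr_gt0.
have [eta eta0 hG] := unif_continuous_norm Gu e10.
pose d := eta / (2 * N).
have d0 : 0 < d by rewrite divr_gt0// mulr_gt0.
pose e2 := eps / (4 * k) / (K + 2 / d).
have Kd0 : 0 < K + 2 / d by rewrite addr_gt0// divr_gt0.
have e20 : 0 < e2 by rewrite !divr_gt0// mulr_gt0.
have [s0 s01 hV] := velocity_cvg e20.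
exists s0 => // s ss0.
have s1 : 1 <= s := le_trans s01 ss0.
have ssd : s < s + d by rewrite ltrDl.
pose u := T (G (X s)).
pose W := fun r => V r + (r - s) *: u.
have hW : `|W (s + d) - W s| <= (tau * e1 + K * e2) * (s + d - s).
  apply: (mean_value_norm ssd (w := fun r => - T (G (X r)) - D (X r) (V r) + u)).
    move=> r; rewrite in_itv /= => /andP[sr _].
    have r0 := posr s1 sr.
    apply: is_deriveD; first exact: dV.
    have ds : is_derive r 1 (fun r : R => r - s) 1.
      by rewrite -[X in is_derive _ _ _ X]subr0; exact: is_deriveB.
    have [su1 su2] : is_diff (r - s) (fun x : R => x *: u) (fun x : R => x *: u).
      exact: is_diff_scalel.
    have := is_derive_comp_diff (Y := fun r : R => r - s) su1 ds.
    by rewrite su2 scale1r.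
  move=> r; rewrite in_itv /= => /andP[sr rd].
  have Xr : `|X r - X s| < eta.
    have : `|X r - X s| <= N * (r - s).
      move: sr; rewrite le_eqVlt => /predU1P[<-|sr].
        by rewrite !subrr normr0 mulr0.
      apply: (mean_value_norm sr (w := V)) => p; rewrite in_itv /= => /andP[sp _].
        by apply: dX; exact: posr sp.
      by apply: VN; exact: le_trans sp.
    move=> /le_lt_trans; apply; apply: (@le_lt_trans _ _ (N * d)).
      by rewrite ler_wpM2l ?(ltW N0)// lerBlDl.
    rewrite (_ : N * d = eta / 2); last by rewrite /d; field; rewrite gt_eqF.
    by rewrite ltr_pdivrMr// ltr_pMr// ltr1n.
  have -> : - T (G (X r)) - D (X r) (V r) + u = T (G (X s) - G (X r)) - D (X r) (V r).
    by rewrite linearB /= addrAC (addrC _ u).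
  rewrite (le_trans (ler_normB _ _))// lerD//.
    by rewrite (le_trans (Ttau _))// ler_wpM2l ?(ltW tau0)// ltW// hG// distrC.
  by rewrite (le_trans (DK _ _))// ler_wpM2l ?(ltW K0)// hV// (le_trans ss0).
have Wd : W (s + d) - W s = V (s + d) - V s + d *: u.
  by rewrite /W subrr scale0r addr0 (addrC s) addrK addrAC.
have h1 : d * `|u| <= (tau * e1 + K * e2) * d + 2 * e2.
  have := ler_normB (W (s + d) - W s) (V (s + d) - V s).
  rewrite {1}Wd addrAC subrr add0r normrZ (gtr0_norm d0).
  move: hW; rewrite (addrC s) addrK => hW.
  have := ler_normB (V (d + s)) (V s).
  have := hV _ ss0; have : `|V (d + s)| <= e2.
    by apply: hV; rewrite (le_trans ss0)// addrC ltW.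
  by lra.
have h2 : k * `|u| <= eps / 2.
  rewrite -(ler_pM2l d0) mulrCA.
  apply: (le_trans (ler_wpM2l (ltW k0) h1)).
  rewrite le_eqVlt; apply/orP; left; apply/eqP; rewrite /e2 /e1; field.
  by rewrite !gt_eqF//= addr_gt0// mulr_gt0.
apply: le_trans (Tk _) _; rewrite -/u (le_trans h2)// ler_pdivrMr// ler_peMr ?ltW//.
by rewrite ltr1n.
Qed.

End Barbalat.

(** * Convergence of the closed-loop system *)

Theorem theorem5p5 (R : realType) (E U : hilbertType R)
  (P : E -> R) (Pmin : R) (Psi : E -> {linear E -> E}) (B : {linear U -> E})
  (P_C1 : C1 P)
  (P_bounded_below : forall x, Pmin <= P x)
  (grad_P_bound : exists2 C : R, 0 < C &
     forall x, `|grad P x| ^+ 2 <= C * (1 + P x - Pmin))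
  (Psi_continuous : forall x, continuous (Psi x))
  (Psi_bounded : [bounded opnorm (Psi x) | x in [set: E]])
  (Psi_self_adjoint : forall x, self_adjoint (Psi x))
  (Psi_psd : forall x, psd (Psi x))
  (B_continuous : continuous B)
  (B_closed_range : closed (range B))
  (c1 c2 : R) (c1_ge0 : 0 <= c1) (c2_small : `|c2| * opnorm (BBs B) < 1)
  (F : E -> U) (F_continuous : continuous F)
  (Phat : E -> R) (Phat_C1 : C1 Phat)
  (matching : forall x, B (F x) = Top B c2 (grad Phat x))
  (xhat : E)
  (X V : R -> E) (X0 V0 : E)
  (X_C1 : C1_within `[0, +oo[ X) (V_C1 : C1_within `[0, +oo[ V)
  (closed_loop : forall t : R, 0 <= t ->
     derive_within `[0, +oo[ (fun s => (X s, V s)) t =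
     (J_cl B c2 \- R_cl B c1 c2 Psi (X t))
       (grad2 (H_cl B c2 P Phat) (X t, V t)))
  (X_init : X 0 = X0) (V_init : V 0 = V0) :
  let T := Top B c2 in
  let Thalf_inv := op_inv (op_sqrt T) in
  let G := grad P \+ grad Phat in
  let cond_i := exists m : R, forall y, m <= P y + Phat y in
  let cond_ii := unif_continuous G /\ [bounded G (X t) | t in `[0, +oo[] in
  let cond_iii := exists2 nu : R, 0 < nu & forall y : E,
    op_ge (Psi y \+ c1 \*: (Thalf_inv \o BBs B \o Thalf_inv)) (nu \*: idfun) in
  let cond_iv := forall eps : R, 0 < eps -> exists2 delta : R, 0 < delta &
    forall y : E, `|G y| <= delta -> `|y - xhat| <= eps in
  (cond_i -> cond_ii -> cond_iii ->
    V t @[t --> +oo] --> (0 : E) /\ G (X t) @[t --> +oo] --> (0 : E)) /\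
  (cond_i -> cond_ii -> cond_iii -> cond_iv ->
    X t @[t --> +oo] --> xhat).
Proof.
move=> Tt Thi Gr cond_i cond_ii cond_iii cond_iv.
have [A [q [q0 q1 Aq As TA]]] := TopE B_continuous c2_small.
have [Qc TK KT] := op_invP q0 q1 Aq TA.
have Qs := op_inv_self_adjoint q0 q1 Aq As TA.
have [a a0 Qa] := op_inv_coercive q0 q1 Aq TA.
have [Sc Ss SS] := op_sqrtP q0 q1 Aq As TA.
have SQ := op_sqrt_inv q0 q1 Aq As TA.
have ISs := op_inv_sqrt_self_adjoint q0 q1 Aq As TA.
have T2 := near_id_le2 q1 Aq TA.
rewrite -/Tt in TA Qc TK KT Qs Qa Sc Ss SS SQ ISs T2 *.
set Q := op_inv Tt in Qc TK KT Qs Qa SQ *.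
set S := op_sqrt Tt in Sc Ss SS SQ ISs *.
pose T : {linear E -> E} := idfun \- A.
have TE x : Tt x = T x by rewrite TA.
pose Bs : {linear E -> E} := mk_linear (BBs_linear B_continuous).
(* [Z] is the [c1] part of [R_cl] applied to the momentum gradient [Q v]; in this factored form one
   root can be moved across the inner product. *)
pose Z : {linear E -> E} := S \o Bs \o S \o Q.
have Zc : continuous Z.
  move=> x; apply: continuous_comp; first exact: Qc.
  apply: continuous_comp; first exact: Sc.
  by apply: continuous_comp; [exact: BBs_continuous|exact: Sc].
pose D x v := T (Psi x v) + c1 *: Z v.
pose e t := H_cl B c2 P Phat (X t, V t).
have Hd z : is_diff z (H_cl B c2 P Phat) (prod_inner (Gr z.1, Q z.2)).
  exact: (is_diff_energy Qc Qs (P_C1.1 _) (Phat_C1.1 _)).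
have Hg z : grad2 (H_cl B c2 P Phat) z = (Gr z.1, Q z.2).
  exact: (grad2_energy Qc Qs (P_C1.1 _) (Phat_C1.1 _)).
have rhs (t : R) : 0 < t -> derive_within `[0, +oo[ (fun s => (X s, V s)) t =
    (V t, - T (Gr (X t)) - D (X t) (V t)).
  move=> t0; rewrite closed_loop ?(ltW t0)// Hg.
  transitivity ((0 + Tt (Q (V t)) - (0 + 0), - Tt (Gr (X t)) + 0 -
    (0 + (Tt (Psi (X t) (Tt (Q (V t)))) + c1 *: Z (V t)))) : E * E).
    by [].
  by rewrite !KT !TE !add0r !addr0 subr0.
have dXV (t : R) : 0 < t -> is_derive t 1 (fun s => (X s, V s))
    (V t, - T (Gr (X t)) - D (X t) (V t)).
  move=> t0; rewrite -rhs//; apply: derivable_within_is_derive => //.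
  have tD : `[0, +oo[%classic t by rewrite /= in_itv /= andbT ltW.
  by apply: derivable_within_pair; [exact: X_C1.1|exact: V_C1.1].
(* The conservative part does no work: ['[Q v, T (Gr x)] = '[v, Gr x]] by self-adjointness of [T],
   which cancels the potential term. *)
have power x v w : prod_inner (Gr x, Q v) (v, - T (Gr x) - w) = - '[Q v, w].
  transitivity ('[Gr x, v] + '[Q v, - T (Gr x) - w]); first by [].
  rewrite innerBr innerNr -TE -(near_id_self_adjoint As TA) KT innerC.
  by rewrite addrA subrr add0r.
have de (t : R) : 0 < t -> is_derive t 1 e (- '[Q (V t), D (X t) (V t)]).
  move=> t0; have [Hd1 Hd2] := Hd (X t, V t).
  rewrite -(power (X t)) -[prod_inner _]Hd2.
  exact: is_derive_comp_diff Hd1 (dXV t t0).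
(* Condition (iv) turns smallness of the gradient into closeness to [xhat], so both conclusions
   reduce to the decay of [V] and of the gradient. *)
suff main : cond_i -> cond_ii -> cond_iii ->
  (forall eps : R, 0 < eps -> exists2 s0, 1 <= s0 &
     forall s, s0 <= s -> `|V s| <= eps) /\
  (forall eps : R, 0 < eps -> exists2 s0, 1 <= s0 &
     forall s, s0 <= s -> `|Gr (X s)| <= eps).
  split=> [ci cii ciii|ci cii ciii civ].
    have [hV hG] := main ci cii ciii.
    split; apply: cvg_pinfty_norm => eps e0.
      by have [s0 _ hs] := hV eps e0; exists s0 => s ss; rewrite subr0 hs.
    by have [s0 _ hs] := hG eps e0; exists s0 => s ss; rewrite subr0 hs.
  have [_ hG] := main ci cii ciii.
  apply: cvg_pinfty_norm => eps e0; have [d d0 hd] := civ eps e0.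
  by have [s0 _ hs] := hG d d0; exists s0 => s ss; apply: hd; exact: hs.
move=> [m hm] [Gu Gb] [nu nu0 hnu].
have [M M0 GM] : exists2 M : R, 0 < M & forall t : R, 0 <= t -> `|Gr (X t)| <= M.
  have [M M0 hM] := pinfty_ex_gt0 Gb; exists M => // t t0.
  by apply: hM; rewrite /= in_itv /= andbT.
have [K K0 DK] : exists2 K : R, 0 < K & forall x v, `|D x v| <= K * `|v|.
  have [K1 K10 hK1] := pinfty_ex_gt0 Psi_bounded.
  have [K2 K20 hK2] := linear_lipschitz Zc.
  (* The factor 2 bounds [T], [K1] bounds every [Psi x], and [K2] bounds [Z]. *)
  exists (2 * K1 + c1 * K2) => [|x v].
    by rewrite ltr_pwDl ?mulr_gt0// mulr_ge0// ltW.
  rewrite (le_trans (ler_normD _ _))// mulrDl lerD//.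
    rewrite -TE (le_trans (T2 _))// -mulrA ler_wpM2l//.
    rewrite (le_trans (opnorm_le (@Psi_continuous x) v))// ler_wpM2r//.
    by apply: le_trans (ler_norm _) (hK1 x Logic.I).
  by rewrite normrZ (ger0_norm c1_ge0) -mulrA ler_wpM2l.
have [k k0 Qk] := linear_lipschitz Qc.
have Tk x : `|x| <= k * `|T x| by rewrite -{1}(TK x) -TE.
have T2' x : `|T x| <= 2 * `|x| by rewrite -TE.
have dis (t : R) : 0 < t -> - '[Q (V t), D (X t) (V t)] <= - (nu * `|V t| ^+ 2).
  move=> _; rewrite lerN2; have [_ /(_ (V t))] := hnu (X t).
  (* Moving [T] onto [Q (V t)] restores [V t] in the first term. Moving one root in the second gives
     [S (Q (V t))], which is [Thi (V t)], on both sides, so (iii) applies. *)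
  have -> : '[Q (V t), D (X t) (V t)] =
      '[Psi (X t) (V t), V t] + c1 * '[Thi (BBs B (Thi (V t))), V t].
    rewrite /D innerDr innerZr -TE -(near_id_self_adjoint As TA) KT innerC.
    congr (_ + _ * _); rewrite ISs -SQ [RHS]innerC.
    transitivity ('[Q (V t), S (BBs B (S (Q (V t))))]); first by [].
    by rewrite -Ss.
  by rewrite /= innerBl innerZl innerDl innerZl inner_norm subr_ge0.
(* Condition (i) bounds the potential part, coercivity of [Q] the kinetic part. *)
have ege (t : R) : m + 2^-1 * a * `|V t| ^+ 2 <= e t.
  by rewrite /e /H_cl -addrA addrC -mulrA lerD // -/Tt -/Q ler_wpM2l.
have a2 : 0 < 2^-1 * a by rewrite mulr_gt0.
have dX (t : R) : 0 < t -> is_derive t 1 X (V t) by move=> /dXV/is_derive_pairP[].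
have dV (t : R) : 0 < t -> is_derive t 1 V (- T (Gr (X t)) - D (X t) (V t)).
  by move=> /dXV/is_derive_pairP[].
split=> eps eps0.
  by apply: (velocity_cvg nu0 a2 M0 K0 _ T2' DK GM dV de dis ege).
by apply: (gradient_cvg nu0 a2 M0 K0 k0 _ T2' Tk DK GM Gu dX dV de dis ege).
Qed.
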